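(* Let $K$ be a field, $S=K[x_0,\ldots,x_n]$ with $x_0<x_1<\cdots<x_n$, let $J\subseteq S$ be a strongly stable monomial ideal and let $G$ be a $J$-marked set. Then the following are equivalent: (a) $G$ is a $J$-marked basis; (b) $\dim_K (G)_m\le\dim_K J_m$ for every $m\ge 0$; (c) $\mathcal N(J)$ is free in $S/(G)$, i.e. the classes of the terms of $\mathcal N(J)$ are linearly independent over $K$ in $S/(G)$.
   Context: A term is a monomial $x^\alpha=x_0^{\alpha_0}\cdots x_n^{\alpha_n}$. A monomial ideal $J$ is strongly stable if for every term $x^\alpha\in J$ and all $0\le i<j\le n$ with $\alpha_i>0$, the term $x_j x^\alpha/x_i$ belongs to $J$. $B_J$ is the minimal set of monomial generators of $J$ and $\mathcal N(J)$ is the set of terms not in $J$. A marked polynomial is a polynomial $f$ with a specified term $Ht(f)$ of its support, its head term. A $J$-marked set is a finite set $G$ of homogeneous marked polynomials $f_\alpha=x^\alpha-\sum c_{\alpha\gamma}x^\gamma$, with $c_{\alpha\gamma}\in K$ and $Ht(f_\alpha)=x^\alpha$, whose head terms are pairwise different and form exactly $B_J$, and such that every $x^\gamma$ appearing belongs to $\mathcal N(J)$. A $J$-marked set $G$ is a $J$-marked basis if $\mathcal N(J)$ is a $K$-basis of $S/(G)$, i.e. $S=(G)\oplus\langle\mathcal N(J)\rangle$ as $K$-vector spaces. For a homogeneous ideal $I$, $I_m$ is the $K$-vector space of its homogeneous elements of degree $m$. *)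

(* Defs.v *)
From HB Require Import structures.
From mathcomp Require Import all_boot all_order all_algebra.
From mathcomp Require Import boolp.
From mathcomp Require Import mpoly.

Set Implicit Arguments.
Unset Strict Implicit.
Unset Printing Implicit Defensive.

Import GRing.Theory.
Local Open Scope ring_scope.
Local Open Scope quotient_scope.

(* Classically every Prop-valued predicate is boolean (boolp), so subspaces and
   ideals are boolean predicates throughout, without loss of generality. *)

Section QuotientSpace.
Variables (K : fieldType) (V : lmodType K) (W : submodClosed V).

(* submodClosed does not inherit from zmodClosed, which the library's quotient
   requires. *)
Definition subspace_pred : {pred V} := fun x => x \in W.

Fact subspace_pred_zmod : zmod_closed subspace_pred.
Proof.
split=> [|x y]; first exact: (rpred0 W).
by move=> xW yW; apply: (rpredD (S := W)) => //; rewrite -scaleN1r; apply: (rpredZ (s := W)).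
Qed.

HB.instance Definition _ :=
  GRing.isZmodClosed.Build V subspace_pred subspace_pred_zmod.

Definition quot_space : Type := Quotient.quot subspace_pred.

HB.instance Definition _ := GRing.Zmodule.on quot_space.

Definition quot_class (x : V) : quot_space := \pi_(Quotient.quot subspace_pred) x.

Lemma quot_class_eq x y : quot_class x = quot_class y <-> x - y \in W.
Proof.
rewrite -[x - y \in W]/(x - y \in subspace_pred) Quotient.idealrBE.
by split=> /eqP.
Qed.

Lemma quot_classD : {morph quot_class : x y / x + y}.
Proof. by move=> x y; rewrite /quot_class !piE. Qed.

Definition quot_scale (a : K) (u : quot_space) : quot_space :=
  quot_class (a *: repr (u : Quotient.quot subspace_pred)).

Lemma quot_classZ a x : quot_class (a *: x) = quot_scale a (quot_class x).
Proof.
apply/quot_class_eq; rewrite -scalerBr rpredZ // -/(quot_class _).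
by apply/quot_class_eq; rewrite /quot_class reprK.
Qed.

Lemma quot_classP (u : quot_space) : exists x, u = quot_class x.
Proof. by exists (repr (u : Quotient.quot subspace_pred)); rewrite /quot_class reprK. Qed.

Fact quot_scaleA a b u : quot_scale a (quot_scale b u) = quot_scale (a * b) u.
Proof. by have [x ->] := quot_classP u; rewrite -!quot_classZ scalerA. Qed.

Fact quot_scale1 : left_id 1 quot_scale.
Proof. by move=> u; have [x ->] := quot_classP u; rewrite -quot_classZ scale1r. Qed.

Fact quot_scaleDr : right_distributive quot_scale +%R.
Proof.
move=> a u v; have [x ->] := quot_classP u; have [y ->] := quot_classP v.
by rewrite -quot_classD -!quot_classZ -quot_classD scalerDr.
Qed.

Fact quot_scaleDl u : {morph quot_scale^~ u : a b / a + b}.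
Proof.
move=> a b /=; have [x ->] := quot_classP u.
by rewrite -!quot_classZ -quot_classD scalerDl.
Qed.

HB.instance Definition _ := GRing.Zmodule_isLmodule.Build K quot_space
  quot_scaleA quot_scale1 quot_scaleDr quot_scaleDl.

End QuotientSpace.

(* Linear algebra for the family (v i), i ranging over the possibly infinite
   set of the i such that N i. *)
Section Families.
Variables (K : fieldType) (V : lmodType K) (I : eqType).
Variables (N : I -> Prop) (v : I -> V).

Definition lin_indep : Prop :=
  forall (s : seq I) (c : I -> K), uniq s -> (forall i, i \in s -> N i) ->
    \sum_(i <- s) c i *: v i = 0 -> forall i, i \in s -> c i = 0.

Definition spanning : Prop :=
  forall x : V, exists (s : seq I) (c : I -> K),
    (forall i, i \in s -> N i) /\ x = \sum_(i <- s) c i *: v i.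

Definition is_basis : Prop := lin_indep /\ spanning.

End Families.

Section Subspace.
Variables (K : fieldType) (V : vectType K).

(* The subspace whose set of elements is W; it is 0 if W is not a subspace. *)
Definition vspace_of (W : {pred V}) : {vspace V} :=
  if pselect (exists U : {vspace V}, U =i W) is left h then sval (cid h)
  else 0%VS.

Lemma vspace_ofP (W : {pred V}) : submod_closed W -> vspace_of W =i W.
Proof.
move=> [W0 WL]; rewrite /vspace_of; case: pselect => [h|]; first exact: (svalP (cid h)).
case; pose P d := `[< exists2 U : {vspace V}, \dim U = d & {subset U <= W} >].
have P0 : exists d, P d.
  exists 0; apply/asboolP; exists 0%VS; first exact: dimv0.
  by move=> x; rewrite memv0 => /eqP->.
have Pb d : P d -> (d <= \dim {:V})%N.
  by move=> /asboolP[U <- _]; rewrite dimvS ?subvf.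
case: (ex_maxnP P0 Pb) => d /asboolP[U dimU UW] dmax; exists U => x.
apply/idP/idP=> [/UW //|xW].
suff /eqP-> : U == (U + <[x]>)%VS.
  by rewrite (subvP (addvSr _ _)) ?memv_line.
rewrite eqEdim addvSl /= dimU; apply: (dmax (\dim _)); apply/asboolP.
exists (U + <[x]>)%VS => // _ /memv_addP[u /UW uW [_ /vlineP[k ->] ->]].
by rewrite addrC WL.
Qed.

End Subspace.

Section Ideals.
Variables (n : nat) (K : fieldType).
Local Notation S := {mpoly K[n.+1]}.
Local Notation term := 'X_{1..n.+1}.

(* The ideal generated by a possibly infinite set A. *)
Definition ideal_gen (A : S -> Prop) : {pred S} :=
  fun p => `[< exists2 s : seq (S * S),
    forall x, x \in s -> A x.2 & p = \sum_(x <- s) x.1 * x.2 >].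

Fact ideal_gen_submod A : submod_closed (ideal_gen A).
Proof.
split; first by apply/asboolP; exists [::]; rewrite ?big_nil.
move=> a p q /asboolP[s sA ->] /asboolP[t tA ->]; apply/asboolP.
exists ([seq (a *: x.1, x.2) | x <- s] ++ t).
  move=> x; rewrite mem_cat => /orP[/mapP[y ys ->]|]; first exact: (sA y).
  exact: tA.
rewrite big_cat big_map scaler_sumr /=; congr (_ + _).
by apply: eq_bigr => x _; rewrite scalerAl.
Qed.

HB.instance Definition _ A :=
  GRing.isSubmodClosed.Build K S (ideal_gen A) (ideal_gen_submod A).

(* I_m, inside the space of homogeneous polynomials of degree m. *)
Definition hom_part (I : {pred S}) (m : nat) : {vspace dhomog n.+1 K m} :=
  vspace_of [pred p : dhomog n.+1 K m | (p : S) \in I].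

Lemma hom_partP I m (p : dhomog n.+1 K m) :
  submod_closed I -> (p \in hom_part I m) = ((p : S) \in I).
Proof.
move=> [I0 IL]; rewrite vspace_ofP ?inE //; split; rewrite ?inE //= => a x y.
by rewrite !inE /=; apply: IL.
Qed.

Definition term_ideal (B : term -> Prop) : {pred S} :=
  ideal_gen (fun p => exists2 a, B a & p = 'X_[a]).

Definition monomial_ideal (J : {pred S}) : Prop :=
  exists B : term -> Prop, J =i term_ideal B.

(* B is the set B_J. *)
Definition is_min_gens (J : {pred S}) (B : term -> Prop) : Prop :=
  J =i term_ideal B /\
  forall B' : term -> Prop, (forall a, B' a -> B a) -> J =i term_ideal B' ->
    forall a, B a -> B' a.

Definition strongly_stable (J : {pred S}) : Prop :=
  forall (a : term) (i j : 'I_n.+1), 'X_[a] \in J -> (i < j)%N -> (0 < a i)%N ->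
    'X_[a - U_(i) + U_(j)] \in J.

(* The set N(J). *)
Definition sous_escalier (J : {pred S}) (a : term) : Prop := 'X_[a] \notin J.

(* A polynomial with a chosen term of its support. *)
Definition marked_poly := {f : S * term | f.2 \in msupp f.1}.
Definition poly_of (f : marked_poly) : S := (val f).1.
Definition Ht (f : marked_poly) : term := (val f).2.

Definition is_marked_set (J : {pred S}) (G : seq marked_poly) : Prop :=
  [/\ forall f, f \in G ->
        [/\ poly_of f \is homog mdeg, (poly_of f)@_(Ht f) = 1 &
            forall a, a \in msupp (poly_of f) -> a != Ht f ->
              sous_escalier J a],
      uniq [seq Ht f | f <- G] &
      is_min_gens J (fun a => a \in [seq Ht f | f <- G])].

Definition marked_ideal (G : seq marked_poly) : {pred S} :=
  ideal_gen (fun p => p \in [seq poly_of f | f <- G]).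

HB.instance Definition _ G := GRing.SubmodClosed.on (marked_ideal G).

(* The class in S/(G) of a term. *)
Definition term_class (G : seq marked_poly) (a : term) :
    quot_space (marked_ideal G) :=
  quot_class (marked_ideal G) 'X_[a].

Definition is_marked_basis (J : {pred S}) (G : seq marked_poly) : Prop :=
  is_basis (sous_escalier J) (term_class G).

End Ideals.

(* Main.v *)
(* Every term of J factors as b e, with b in B_J and no variable
   of e larger than a variable of b (strong stability gives existence).
   Rewriting b e with the marked polynomial of head b produces terms c e with c
   in N(J); if c e is again in J, it factors as b' e' with e' lexicographically
   smaller than e, since otherwise b' would divide c.  So rewriting terminates
   and S = (G) + <N(J)>, degree by degree.  Hence being a marked basis means
   (G) and <N(J)> meet in 0.  As <N(J)>_m is also a complement of J_m, the
   excess dim (G)_m - dim J_m is the dimension of the intersection in degree m,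
   and (G) is homogeneous. *)

Require Import Defs.
From HB Require Import structures.
From mathcomp Require Import all_boot all_order all_algebra.
From mathcomp Require Import boolp mpoly.
From mathcomp Require Import zify.

Set Implicit Arguments.
Unset Strict Implicit.
Unset Printing Implicit Defensive.

Import GRing.Theory.
Local Open Scope ring_scope.

(** * Base-N numerals and lexicographic comparison *)

Lemma sum_digits_lt (N n : nat) (f : nat -> nat) :
  (forall i, (i < n)%N -> (f i < N)%N) -> (\sum_(i < n) f i * N ^ i < N ^ n)%N.
Proof.
elim: n => [|n IHn] fN; first by rewrite big_ord0.
rewrite big_ord_recr /= expnS.
have {}IHn := IHn (fun i lt_in => fN i (ltnW lt_in)).
apply: leq_trans (leq_mul (fN n (ltnSn n)) (leqnn _)).
by rewrite mulSn ltn_add2r.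
Qed.

(** The digits of [f] below [j] contribute less than [N ^ j], which cannot make up for a deficit of
    at least one unit at [j]. *)
Lemma sum_digits_lex (N n j : nat) (f g : nat -> nat) :
  (forall i, (i < n)%N -> (f i < N)%N) -> (j < n)%N -> (f j < g j)%N ->
  (forall i, (j < i < n)%N -> f i = g i) ->
  (\sum_(i < n) f i * N ^ i < \sum_(i < n) g i * N ^ i)%N.
Proof.
move=> fN jn fgj; elim: n jn fN => [//|n IHn] jn fN fg; rewrite !big_ord_recr /=.
have [eqjn|neqjn] := eqVneq j n.
  subst j; have := @sum_digits_lt N n f (fun i lt_in => fN i (ltnW lt_in)).
  move=> /leq_trans ltN; rewrite -addSn.
  apply: leq_trans (leq_addl _ _); apply: leq_trans (leq_mul fgj (leqnn _)).
  by rewrite mulSn leq_add2r; apply: ltN.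
rewrite fg; last by lia.
rewrite ltn_add2r; apply: IHn => [|i lt_in|i lt_jin]; first by lia.
  by apply: fN; lia.
by apply: fg; lia.
Qed.

Lemma quot_class0 (K : fieldType) (V : lmodType K) (W : submodClosed V) :
  quot_class W 0 = 0.
Proof. by apply: (@addrI _ (quot_class W 0)); rewrite -quot_classD !addr0. Qed.

(** * Factorizations of terms and their lexicographic descent *)

Section Terms.
Variable n : nat.
Local Notation term := 'X_{1..n.+1}.
Implicit Types a b e g : term.

(** This is the condition of the Eliahou-Kervaire factorization in a stable ideal, for variables
    that increase with the index. *)
Definition star_disjoint a e :=
  forall i j : 'I_n.+1, (0 < a i)%N -> (0 < e j)%N -> (j <= i)%N.

(* For exponents below N, comparing base-N numerals is the lexicographic
   comparison in which the largest variable weighs most. *)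
Definition lex_code (N : nat) e := (\sum_(i < n.+1) e (inord i) * N ^ i)%N.

Lemma mnm_le_mdeg e i : (e i <= mdeg e)%N.
Proof. by rewrite mdegE (bigD1 i) //= leq_addr. Qed.

Lemma lex_code_lt N e e' (j : 'I_n.+1) :
  (mdeg e' < N)%N -> (e' j < e j)%N ->
  (forall k : 'I_n.+1, (j < k)%N -> e' k = e k) -> (lex_code N e' < lex_code N e)%N.
Proof.
move=> e'N e'ej e'e.
apply: (@sum_digits_lex N n.+1 j (e' \o inord) (e \o inord)) => /=.
- by move=> i _; apply: leq_ltn_trans e'N; apply: mnm_le_mdeg.
- exact: ltn_ord.
- by rewrite !inord_val.
- by move=> i /andP[ji ni]; rewrite e'e ?inordK.
Qed.

(** Take the largest [j] where [e] and [e'] differ. If [e j < e' j], then [x_j] divides [e'], so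
    [a'] vanishes below [j]; at [j] it is smaller than [a], and above [j] it agrees with [a]. Then
    [a'] would divide [a]. *)
Lemma star_descent a e a' e' :
  (a' + e')%MM = (a + e)%MM -> star_disjoint a' e' -> ~~ (a' <= a)%MM ->
  exists2 j : 'I_n.+1, (e' j < e j)%N & forall k : 'I_n.+1, (j < k)%N -> e' k = e k.
Proof.
move=> /mnmP eqae star; apply: contraNP => nolex.
have {}eqae i : (a' i + e' i = a i + e i)%N by have := eqae i; rewrite !mnmDE.
case: (pickP (fun j => e' j != e j)) => [j0 j0P|eqe]; last first.
  by apply/mnm_lepP => i; have := eqae i; have /negbFE/eqP-> := eqe i; lia.
case: (@arg_maxnP _ j0 (fun j => e' j != e j) (@nat_of_ord n.+1) j0P) => j jP jmax.
have eqgt (k : 'I_n.+1) : (j < k)%N -> e' k = e k.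
  by move=> jk; apply/eqP; apply: contraTT jk => /jmax; lia.
have eltj : (e j < e' j)%N.
  rewrite ltn_neqAle eq_sym jP /= leqNgt; apply/negP => ltj; apply: nolex.
  by exists j.
apply/mnm_lepP => i; have := eqae i.
have [ij|ji|/val_inj->] := ltngtP i j; last by lia.
  case: (posnP (a' i)) => [-> //|a'i]; have := star i j a'i; lia.
by rewrite eqgt //; lia.
Qed.

End Terms.

(** * Ideals generated by terms *)

Section Ideals.
Variables (K : fieldType) (n : nat).
Local Notation S := {mpoly K[n.+1]}.
Local Notation term := 'X_{1..n.+1}.
Implicit Types (J : {pred S}) (B : term -> Prop) (A : S -> Prop).

Lemma ideal_gen_mem A p : A p -> p \in ideal_gen A.
Proof.
move=> Ap; apply/asboolP; exists [:: (1, p)]; last by rewrite big_seq1 mul1r.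
by move=> x; rewrite inE => /eqP->.
Qed.

Lemma ideal_genM A p q : p \in ideal_gen A -> q * p \in ideal_gen A.
Proof.
move=> /asboolP[s sA ->]; apply/asboolP.
exists [seq (q * x.1, x.2) | x <- s] => [_ /mapP[x xs ->]|]; first exact: (sA x).
by rewrite big_map mulr_sumr; apply: eq_bigr => x _; rewrite mulrA.
Qed.

Lemma term_idealP B p :
  p \in term_ideal (K := K) B <-> forall a, a \in msupp p -> exists2 b, B b & (b <= a)%MM.
Proof.
split=> [/asboolP[s sB ->] a|supp].
  move=> /msupp_sum_le /flattenP[_ /mapP[x xs ->]].
  rewrite mem_filter /= in xs; have [b Bb ->] := sB _ xs.
  move=> /msuppM_le /allpairsP[[c d] /= [_ /mem_msuppXP <- ->]].
  by exists b => //; apply/mnm_lepP => i; rewrite mnmDE leq_addl.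
rewrite (mpolyE p) big_seq; apply: rpred_sum => a /supp[b Bb /submK <-].
rewrite mpolyXD scalerAl; apply/ideal_genM/ideal_gen_mem.
by exists b.
Qed.

Lemma term_ideal_mnmP B a :
  'X_[a] \in term_ideal (K := K) B <-> exists2 b, B b & (b <= a)%MM.
Proof.
rewrite term_idealP; split=> [|ex _ /mem_msuppXP<- //]; apply.
by rewrite msuppX inE.
Qed.

Lemma monomial_ideal_supp J p : monomial_ideal J ->
  (p \in J) = all (fun a => 'X_[a] \in J) (msupp p).
Proof.
move=> [B JB]; rewrite JB; apply/idP/allP => [/term_idealP pB a ap|pJ].
  by rewrite JB; apply/term_ideal_mnmP/pB.
by apply/term_idealP => a /pJ; rewrite JB => /term_ideal_mnmP.
Qed.

(** Induction on the degree: unless [b] equals the generator found to divide it, its smallest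
    variable [x_m] can be stripped without leaving [J]. Returning [x_m] to the cofactor keeps the
    factorization star-disjoint because [m] is minimal in [b]. *)
Lemma star_decomposition J B b :
  J =i term_ideal (K := K) B -> strongly_stable J -> 'X_[b] \in J ->
  exists a e, [/\ B a, b = (a + e)%MM & star_disjoint a e].
Proof.
move=> JB stab; have [d] := ubnP (mdeg b).
elim: d => // d IHd in b *; rewrite ltnS => bd Jb.
move: (Jb); rewrite JB => /term_ideal_mnmP[a Ba leab].
have [eqab|neqab] := eqVneq a b.
  exists a, 0%MM; split=> //; first by rewrite addm0.
  by move=> i j _; rewrite mnm0E.
have /existsP[i ltabi] : [exists i, (a i < b i)%N].
  apply: contraNT neqab => /existsPn geab; apply/eqP/mnmP => i.
  by apply/eqP; rewrite eqn_leq (mnm_lepP leab) leqNgt geab.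
have Jbi : 'X_[b - U_(i)] \in J.
  rewrite JB; apply/term_ideal_mnmP; exists a => //; apply/mnm_lepP => k.
  by rewrite mnmBE mnm1E; have := mnm_lepP leab k; case: eqP => [<-|_]; lia.
have bi : (0 < b i)%N by lia.
case: (@arg_minnP _ i (fun j => 0 < b j)%N (@nat_of_ord n.+1) bi) => m bm mmin.
(* b - U_(m) is obtained from b - U_(i) by trading x_m for the larger x_i. *)
have Jbm : 'X_[b - U_(m)] \in J.
  have [-> //|neqmi] := eqVneq m i.
  have ltmi : (m < i)%N by rewrite ltn_neqAle mmin ?andbT.
  have /stab := Jbi => /(_ m i ltmi).
  rewrite mnmBE mnm1E [i == m]eq_sym (negPf neqmi) subn0 => /(_ bm).
  congr ('X_[_] \in J); apply/mnmP => k; rewrite !(mnmDE, mnmBE, mnm1E).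
  by case: (eqVneq i k) => [eqik|_]; case: (eqVneq m k) => [eqmk|_]; subst; lia.
have bmK : (b - U_(m) + U_(m))%MM = b.
  by apply: submK; apply/mnm_lepP => k; rewrite mnm1E; case: eqP => [<-|].
have mdeg_bm : (mdeg (b - U_(m)) < d)%N.
  by move: bd; rewrite -{1}bmK mdegD mdeg1; lia.
have [a' [e [Ba' bmE star]]] := IHd _ mdeg_bm Jbm.
exists a', (e + U_(m))%MM; split=> //; first by rewrite addmA -bmE bmK.
move=> k l a'k; rewrite mnmDE mnm1E; have [<- _|_] := eqVneq m l.
  by apply: mmin; rewrite -bmK bmE !mnmDE /=; lia.
by rewrite addn0; apply: star.
Qed.


(** * Spaces of polynomials spanned by terms *)

Section Supported.
Variable P : pred term.

(** It serves both for a monomial ideal, with [P] membership in it, and for the span of its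
    sous-escalier. *)
Definition supported : {pred S} := fun p => all P (msupp p).

Fact supported_submod : submod_closed supported.
Proof.
split=> [|c p q /allP pP /allP qP]; rewrite /supported unfold_in ?msupp0 //.
apply/allP => a /msuppD_le; rewrite mem_cat => /orP[/msuppZ_le|]; first exact: pP.
exact: qP.
Qed.

HB.instance Definition _ :=
  GRing.isSubmodClosed.Build K S supported supported_submod.

Lemma supportedX a : ('X_[a] \in supported) = P a.
Proof. by rewrite unfold_in /supported msuppX /= andbT. Qed.

End Supported.

Lemma supported_split P p d : p \is d.-homog ->
  exists q r, [/\ q \is d.-homog, r \is d.-homog, q \in supported P,
    r \in supported (predC P) & p = q + r].
Proof.
move=> /dhomogP pd.
exists (\sum_(a <- msupp p | P a) p@_a *: 'X_[a]),
  (\sum_(a <- msupp p | ~~ P a) p@_a *: 'X_[a]).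
split; last by rewrite {1}(mpolyE p) (bigID P).
- rewrite big_seq_cond; apply: rpred_sum => a /andP[/pd ad _].
  by apply: rpredZ; rewrite dhomogX; apply/eqP.
- rewrite big_seq_cond; apply: rpred_sum => a /andP[/pd ad _].
  by apply: rpredZ; rewrite dhomogX; apply/eqP.
- by apply: rpred_sum => a Pa; apply: rpredZ; rewrite supportedX.
- by apply: rpred_sum => a Pa; apply: rpredZ; rewrite supportedX.
Qed.

Lemma supported_disjoint P p :
  p \in supported P -> p \in supported (predC P) -> p = 0.
Proof.
move=> /allP pP /allP pN; apply/eqP; rewrite -msupp_eq0.
by case: (msupp p) pP pN => // a s /(_ a (mem_head _ _)) Pa /(_ a (mem_head _ _)) /negP.
Qed.

(** Once the coefficients are expanded into terms, each summand is homogeneous, and its component of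
    degree [d] is itself or 0. *)
Lemma homogeneous_ideal_pihomog A d p :
  (forall q, A q -> q \is homog mdeg) ->
  p \in ideal_gen A -> pihomog mdeg d p \in ideal_gen A.
Proof.
move=> Ahom /asboolP[s sA ->]; rewrite linear_sum big_seq /=.
apply: rpred_sum => x /sA Ax; have /homogP[e x2e] := Ahom _ Ax.
rewrite (mpolyE x.1) mulr_suml linear_sum; apply: rpred_sum => a _ /=.
have homax : p@_a *: 'X_[a] * x.2 \is (mdeg a + e).-homog.
  by apply: dhomogM x2e; apply: rpredZ; rewrite dhomogX.
rewrite -scalerAl linearZ /=; apply: rpredZ.
have {}homax : 'X_[a] * x.2 \is (mdeg a + e).-homog.
  by apply: dhomogM x2e; rewrite dhomogX.
have [<-|neqd] := eqVneq (mdeg a + e)%N d.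
  by rewrite pihomog_dE //; apply/ideal_genM/ideal_gen_mem.
by rewrite (pihomog_ne0 neqd homax) rpred0.
Qed.

End Ideals.

(** * Reduction modulo a marked set *)

Section MarkedSet.
Variables (K : fieldType) (n : nat) (J : {pred {mpoly K[n.+1]}}).
Variable G : seq (marked_poly n K).
Hypotheses (Jmon : monomial_ideal J) (stab : strongly_stable J).
Hypothesis GJ : is_marked_set J G.
Local Notation S := {mpoly K[n.+1]}.
Local Notation term := 'X_{1..n.+1}.
Local Notation I := (marked_ideal G).
Implicit Types (p q : S).

Let inJ : pred term := fun a => 'X_[a] \in J.
Local Notation normal := (supported (predC inJ)).

Lemma marked_ideal_pihomog d p : p \in I -> pihomog mdeg d p \in I.
Proof.
apply: homogeneous_ideal_pihomog => _ /mapP[f fG ->].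
by have [/(_ f fG)[]] := GJ.
Qed.

(** Only the remainder [q] is bound to degree [d], so that any element of the ideal reduces to 0
    whatever its degree. *)
Definition reducible d p :=
  exists q, [/\ q \is d.-homog, q \in normal & p - q \in I].

Lemma reducible_lin d c p q :
  reducible d p -> reducible d q -> reducible d (c *: p + q).
Proof.
move=> [p' [p'd p'N p'I]] [q' [q'd q'N q'I]]; exists (c *: p' + q'); split.
- by apply: rpredD q'd; apply: rpredZ.
- by apply: rpredD q'N; apply: rpredZ.
- by rewrite opprD addrACA -scalerBr; apply: rpredD q'I; apply: rpredZ.
Qed.

Lemma reducible_ideal d p : p \in I -> reducible d p.
Proof. by move=> pI; exists 0; rewrite subr0 !rpred0. Qed.

Lemma reducible_sum d (T : eqType) (s : seq T) (c : T -> K) (F : T -> S) :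
  (forall i, i \in s -> reducible d (F i)) ->
  reducible d (\sum_(i <- s) c i *: F i).
Proof.
elim: s => [|i s IHs] redF; first by rewrite big_nil; apply/reducible_ideal/rpred0.
rewrite big_cons; apply: reducible_lin; first by apply: redF; apply: mem_head.
by apply: IHs => j js; apply: redF; rewrite inE js orbT.
Qed.

Lemma reducible_normal_term a : ~~ inJ a -> reducible (mdeg a) 'X_[a].
Proof. by exists 'X_[a]; rewrite subrr rpred0 supportedX dhomogX. Qed.

Lemma reducible_star_product d a e :
  a \in [seq Ht f | f <- G] -> star_disjoint a e -> mdeg (a + e)%MM = d ->
  reducible d 'X_[a + e].
Proof.
have [Gf _ [JG _]] := GJ.
(* The base [d.+1] exceeds every exponent of a cofactor of degree at most [d], so the code follows
   the lexicographic order. *)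
have [k] := ubnP (lex_code d.+1 e).
elim: k => // k IHk in a e *; rewrite ltnS => ek /mapP[f fG aE] star ded.
have [fhom f1 fN] := Gf f fG.
have fI : poly_of f \in I by apply/ideal_gen_mem/map_f.
have fa : (poly_of f)@_a = 1 by rewrite aE.
have asupp : a \in msupp (poly_of f) by rewrite mcoeff_msupp fa oner_eq0.
have fd b : b \in msupp (poly_of f) -> mdeg b = mdeg a.
  by move=> bf; have /homogP[c /dhomogP fc] := fhom; rewrite !fc.
have fE : poly_of f = 'X_[a] +
    \sum_(b <- rem a (msupp (poly_of f))) (poly_of f)@_b *: 'X_[b].
  by rewrite {1}(mpolyE (poly_of f)) (big_rem a) //= fa scale1r.
(* One rewriting step: modulo the ideal, the head is traded for the tail of [f] shifted by [e]. *)
have -> : 'X_[a + e] = (-1) *: (\sum_(b <- rem a (msupp (poly_of f)))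
    (poly_of f)@_b *: 'X_[b + e]) + poly_of f * 'X_[e].
  rewrite {3}fE mulrDl -mpolyXD addrCA scaleN1r mulr_suml.
  rewrite (eq_bigr (fun b => (poly_of f)@_b *: 'X_[b] * 'X_[e])) ?addNr ?addr0 //.
  by move=> b _; rewrite mpolyXD scalerAl.
apply: reducible_lin; last by rewrite mulrC; apply/reducible_ideal/ideal_genM.
apply: reducible_sum => b; rewrite mem_rem_uniq ?msupp_uniq // !inE => /andP[ba bf].
have bN : sous_escalier J b by apply: fN; rewrite -?aE.
have bed : mdeg (b + e)%MM = d by rewrite -ded !mdegD fd.
have [beJ|beN] := boolP (inJ (b + e)%MM); last first.
  by rewrite -bed; apply: reducible_normal_term.
have [a' [e' [Ga' beE star']]] := star_decomposition JG stab beJ.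
(* A head term dividing the tail term [b] would put [b] in [J]. *)
have leab : ~~ (a' <= b)%MM.
  by apply: contra bN => le; rewrite JG; apply/term_ideal_mnmP; exists a'.
have [j ltj eqj] := star_descent (esym beE) star' leab.
rewrite beE; apply: IHk => //; last by rewrite -beE.
apply: leq_trans ek; apply: lex_code_lt ltj eqj.
by rewrite ltnS -bed beE mdegD leq_addl.
Qed.

Lemma reducible_term a : reducible (mdeg a) 'X_[a].
Proof.
have [_ _ [JG _]] := GJ.
have [aJ|aN] := boolP (inJ a); last exact: reducible_normal_term.
have [b [e [Gb -> star]]] := star_decomposition JG stab aJ.
exact: reducible_star_product star _.
Qed.

Lemma reducible_homog d p : p \is d.-homog -> reducible d p.
Proof.
move=> /dhomogP pd; rewrite (mpolyE p); apply: reducible_sum => a /pd <-.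
exact: reducible_term.
Qed.

Lemma reducible_mpoly p : exists2 q, q \in normal & p - q \in I.
Proof.
rewrite (mpolyE p); elim/big_ind: _.
- by exists 0; rewrite ?subr0 ?rpred0.
- move=> p1 p2 [q1 q1N q1I] [q2 q2N q2I]; exists (q1 + q2); first exact: rpredD.
  by rewrite opprD addrACA; apply: rpredD.
- move=> a _; have [q [_ qN qI]] := reducible_term a; exists (p@_a *: q).
    exact: rpredZ.
  by rewrite -scalerBr; apply: rpredZ.
Qed.

Lemma term_class_sum (s : seq term) (c : term -> K) :
  \sum_(a <- s) c a *: term_class G a =
  quot_class I (\sum_(a <- s) c a *: 'X_[a]).
Proof.
rewrite (big_morph (quot_class I) (@quot_classD _ _ I) (quot_class0 _)).
by apply: eq_bigr => a _; rewrite quot_classZ.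
Qed.

(** This half of the basis property holds for every marked set, which leaves only independence to
    characterize. *)
Lemma spanning_normal : spanning (sous_escalier J) (term_class G).
Proof.
move=> x; have [p ->] := quot_classP x; have [q /allP qN qI] := reducible_mpoly p.
exists (msupp q), (fun a => q@_a); split; first exact: qN.
by rewrite term_class_sum -mpolyE; apply/quot_class_eq.
Qed.

(** The coefficients of a relation between classes are those of a normal polynomial lying in the
    ideal. *)
Lemma lin_indep_normalP :
  lin_indep (sous_escalier J) (term_class G) <->
  forall p, p \in I -> p \in normal -> p = 0.
Proof.
split=> [indep p pI /allP pN|normal0 s c us sN].
  apply/eqP; rewrite -msupp_eq0; case E: (msupp p) => [//|a s].
  have ap : a \in msupp p by rewrite E mem_head.
  have := ap; rewrite mcoeff_msupp (indep (msupp p) (fun a => p@_a)) ?eqxx //.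
  by rewrite term_class_sum -mpolyE -(quot_class0 I); apply/quot_class_eq; rewrite subr0.
rewrite term_class_sum -(quot_class0 I) => /quot_class_eq; rewrite subr0 => sumI a sa.
have /(_ _ sumI) := normal0.
have sumN : \sum_(b <- s) c b *: 'X_[b] \in normal.
  rewrite big_seq; apply: rpred_sum => b /sN bN; apply: rpredZ.
  by rewrite supportedX.
move=> /(_ sumN) /(congr1 (mcoeff a)); rewrite mcoeff0 raddf_sum /= => <-.
rewrite (bigD1_seq a) //= mcoeffZ mcoeffX eqxx mulr1 big1 ?addr0 // => b ba.
by rewrite mcoeffZ mcoeffX (negPf ba) mulr0.
Qed.

(** * Dimension count in a fixed degree *)

Section Degree.
Variable m : nat.
Local Notation V := (dhomog n.+1 K m).

Let N_m : {vspace V} := hom_part normal m.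

Lemma mem_hom_part_normal (p : V) : (p \in N_m) = ((p : S) \in normal).
Proof. by rewrite hom_partP //; apply: supported_submod. Qed.

Lemma mem_hom_part_I (p : V) : (p \in hom_part I m) = ((p : S) \in I).
Proof. by rewrite hom_partP //; apply: ideal_gen_submod. Qed.

Lemma mem_hom_part_J (p : V) : (p \in hom_part J m) = ((p : S) \in supported inJ).
Proof.
(* [J] is a bare predicate; the closure that [hom_partP] requires is transferred from
   [supported inJ]. *)
have eqJ : J =i supported inJ by move=> q; rewrite (monomial_ideal_supp _ Jmon).
rewrite hom_partP -?eqJ //; have [s0 sL] := supported_submod K inJ.
split; first by rewrite eqJ.
by move=> c p1 p2; rewrite !eqJ; apply: sL.
Qed.

Lemma dim_hom_part_J : (\dim (hom_part J m) + \dim N_m)%N = \dim {:V}.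
Proof.
rewrite -dimv_disjoint_sum.
  congr (\dim _); apply/eqP; rewrite eqEsubv subvf /=; apply/subvP => p _.
  have [q [r [qd rd qJ rN pE]]] := supported_split inJ (dhomog_is_dhomog p).
  apply/memv_addP; exists (DHomog qd); first by rewrite mem_hom_part_J.
  exists (DHomog rd); first by rewrite mem_hom_part_normal.
  exact: val_inj.
apply/eqP; rewrite -subv0; apply/subvP => p; rewrite memv_cap memv0.
rewrite mem_hom_part_J mem_hom_part_normal => /andP[pJ pN].
by apply/eqP/val_inj/(supported_disjoint pJ pN).
Qed.

(** Reduction makes the ideal and the normal polynomials span the whole degree; the dimension
    formula for a sum, compared with [dim_hom_part_J], then gives the excess. *)
Lemma dim_hom_part_I :
  \dim (hom_part I m) = (\dim (hom_part J m) + \dim (hom_part I m :&: N_m))%N.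
Proof.
have sumI : (hom_part I m + N_m)%VS = fullv.
  apply/eqP; rewrite eqEsubv subvf /=; apply/subvP => p _.
  have [q [qd qN qI]] := reducible_homog (dhomog_is_dhomog p).
  apply/memv_addP; exists (p - DHomog qd); first by rewrite mem_hom_part_I.
  by exists (DHomog qd); rewrite ?mem_hom_part_normal ?subrK.
have := dimv_sum_cap (hom_part I m) N_m; rewrite sumI -dim_hom_part_J.
by rewrite addnAC => /addIn.
Qed.

End Degree.

(** By [dim_hom_part_I], the inequality in degree [m] says exactly that the intersection in that
    degree is 0. *)
Lemma hom_part_leP :
  (forall m, (\dim (hom_part I m) <= \dim (hom_part J m))%N) <->
  forall p, p \in I -> p \in normal -> p = 0.
Proof.
split=> [dimIJ p pI /allP pN|normal0 m].
  (* The inequality concerns homogeneous elements only, so [p] is cut into components, each still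
     normal and in the ideal. *)
  rewrite (pihomog_partitionE (leqnn (msize p))) big1 // => d _.
  have dI := marked_ideal_pihomog d pI.
  have := dim_hom_part_I d; have := dimIJ d => le eqd.
  have /eqP : \dim (hom_part I d :&: hom_part normal d)%VS = 0%N by lia.
  rewrite dimv_eq0 => /eqP cap0.
  have : DHomog (pihomogP mdeg d p) \in (hom_part I d :&: hom_part normal d)%VS.
    rewrite memv_cap mem_hom_part_I mem_hom_part_normal dI /=.
    rewrite pihomogE big_seq_cond; apply: rpred_sum => a /andP[ap _].
    by apply: rpredZ; rewrite supportedX; apply: pN.
  by rewrite cap0 memv0 => /eqP/(congr1 val).
rewrite dim_hom_part_I (_ : (_ :&: _)%VS = 0%VS) ?dimv0 ?addn0 //.
apply/eqP; rewrite -subv0; apply/subvP => p.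
rewrite memv_cap memv0 mem_hom_part_I mem_hom_part_normal => /andP[pI pN].
exact/eqP/val_inj/normal0.
Qed.

End MarkedSet.

Theorem corollary2p4 (K : fieldType) (n : nat) (J : {pred {mpoly K[n.+1]}})
    (G : seq (marked_poly n K)) :
  monomial_ideal J -> strongly_stable J -> is_marked_set J G ->
  (is_marked_basis J G <->
     (forall m : nat,
        (\dim (hom_part (marked_ideal G) m) <= \dim (hom_part J m))%N)) /\
  (is_marked_basis J G <-> lin_indep (sous_escalier J) (term_class G)).
Proof.
move=> Jmon stab GJ; have span := spanning_normal stab GJ.
(* The dimension condition becomes linear independence, so both equivalences turn into the same one,
   settled by [span]. *)
rewrite (hom_part_leP Jmon stab GJ) -lin_indep_normalP.
by split; split=> [[]|].
Qed.
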